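(* Every medial left quasigroup is nilpotent of length at most $2$.
   Context: A left quasigroup is a (nonempty) set $Q$ with binary operations $*,\backslash$ such that $x*(x\backslash y)=y=x\backslash(x*y)$; equivalently every $L_x:y\mapsto x*y$ is a bijection. It is medial if $(x*y)*(z*u)=(x*z)*(y*u)$ for all $x,y,z,u$. Congruences are equivalence relations compatible with $*$ and $\backslash$. Nilpotence is in the sense of commutator theory: for congruences $\alpha,\beta,\delta$ of an algebra $A$, $C(\alpha,\beta;\delta)$ means that for every $(k+1)$-ary term operation $t$, every $a\,\alpha\,b$ and all $u_1\,\beta\,v_1,\ldots,u_k\,\beta\,v_k$, $t(a,u_1,\ldots,u_k)\,\delta\,t(a,v_1,\ldots,v_k)$ implies $t(b,u_1,\ldots,u_k)\,\delta\,t(b,v_1,\ldots,v_k)$. A congruence $\alpha$ is central if $C(\alpha,1_A;0_A)$, where $0_A$ is equality and $1_A=A\times A$. $A$ is nilpotent if there is a chain of congruences $0_A=\alpha_0\leq\ldots\leq\alpha_m=1_A$ with $\alpha_{i+1}/\alpha_i$ central in $A/\alpha_i$ for all $i$; the smallest such $m$ is the length of nilpotence. *)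

(* Defs.v *)
From mathcomp Require Import all_boot.
From mathcomp Require Import boolp classical_sets.

Set Implicit Arguments.
Unset Strict Implicit.
Unset Printing Implicit Defensive.

Local Open Scope classical_set_scope.

Declare Scope lquasi_scope.
Delimit Scope lquasi_scope with lq.

Record leftQuasigroup := LeftQuasigroup {
  carrier :> Type;
  lq_mul : carrier -> carrier -> carrier;
  lq_ldiv : carrier -> carrier -> carrier;
  lq_inhabited : inhabited carrier;
  lq_mulK : forall x y, lq_mul x (lq_ldiv x y) = y;
  lq_ldivK : forall x y, lq_ldiv x (lq_mul x y) = y
}.

Notation "x * y" := (lq_mul x y) : lquasi_scope.
Notation "x \ y" := (lq_ldiv x y)
  (at level 40, left associativity) : lquasi_scope.

Local Open Scope lquasi_scope.

Definition medial (Q : leftQuasigroup) : Prop :=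
  forall x y z u : Q, (x * y) * (z * u) = (x * z) * (y * u).

Record congruence (A : leftQuasigroup) := Congruence {
  cong_rel :> A -> A -> Prop;
  cong_refl : forall x, cong_rel x x;
  cong_sym : forall x y, cong_rel x y -> cong_rel y x;
  cong_trans : forall x y z, cong_rel x y -> cong_rel y z -> cong_rel x z;
  cong_mul : forall x x' y y',
    cong_rel x x' -> cong_rel y y' -> cong_rel (x * y) (x' * y');
  cong_ldiv : forall x x' y y',
    cong_rel x x' -> cong_rel y y' -> cong_rel (x \ y) (x' \ y')
}.

Definition cong_le (A : leftQuasigroup) (alpha beta : congruence A) : Prop :=
  forall x y, alpha x y -> beta x y.

Definition cong0 (A : leftQuasigroup) : congruence A.
Proof.
by apply: (@Congruence A (fun x y => x = y)) => [|x y ->|x y z ->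
  |x x' y y' -> ->|x x' y y' -> ->].
Defined.

Definition cong1 (A : leftQuasigroup) : congruence A :=
  @Congruence A (fun _ _ => True) (fun _ => I) (fun _ _ _ => I)
    (fun _ _ _ _ _ => I) (fun _ _ _ _ _ _ => I) (fun _ _ _ _ _ _ => I).

Inductive term (n : nat) : Type :=
| TVar of 'I_n
| TMul of term n & term n
| TLdiv of term n & term n.

Fixpoint term_eval (A : leftQuasigroup) (n : nat) (e : 'I_n -> A)
    (t : term n) : A :=
  match t with
  | TVar i => e i
  | TMul t1 t2 => term_eval e t1 * term_eval e t2
  | TLdiv t1 t2 => term_eval e t1 \ term_eval e t2
  end.

(* The assignment (a, u_1, ..., u_k) of k.+1 variables. *)
Definition env_cons (T : Type) (k : nat) (a : T) (u : 'I_k -> T)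
    (i : 'I_k.+1) : T :=
  if unlift ord0 i is Some j then u j else a.

(* C(alpha, beta; delta) *)
Definition centralizes (A : leftQuasigroup) (alpha beta delta : congruence A)
    : Prop :=
  forall (k : nat) (t : term k.+1) (a b : A) (u v : 'I_k -> A),
    alpha a b -> (forall i, beta (u i) (v i)) ->
    delta (term_eval (env_cons a u) t) (term_eval (env_cons a v) t) ->
    delta (term_eval (env_cons b u) t) (term_eval (env_cons b v) t).

Definition central (A : leftQuasigroup) (alpha : congruence A) : Prop :=
  centralizes alpha (cong1 A) (cong0 A).

Section Quotient.
Variables (A : leftQuasigroup) (alpha : congruence A).

Definition quot_carrier : Type := {X : set A | exists a, X = [set b | alpha a b]}.

Definition quot_class (a : A) : quot_carrier :=
  exist _ [set b | alpha a b] (ex_intro _ a erefl).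

Lemma quot_class_surj (X : quot_carrier) : exists a, X = quot_class a.
Proof. by case: X => X [a Xa]; exists a; apply: eq_exist. Qed.

Lemma quot_classP (a b : A) : quot_class a = quot_class b <-> alpha a b.
Proof.
split=> [/(congr1 (fun X => sval X b)) /= e|ab].
  by rewrite e; apply: cong_refl.
apply: eq_exist; apply/seteqP; split=> c /= h.
  exact: cong_trans (cong_sym ab) h.
exact: cong_trans ab h.
Qed.

Lemma quot_op_subproof (op : A -> A -> A)
    (opP : forall x x' y y', alpha x x' -> alpha y y' ->
      alpha (op x y) (op x' y')) (X Y : quot_carrier) :
  exists a, [set c | exists x y, [/\ sval X x, sval Y y & alpha (op x y) c]]
    = [set b | alpha a b].
Proof.
have [a ->] := quot_class_surj X; have [b ->] := quot_class_surj Y.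
exists (op a b); apply/seteqP; split=> c /=.
  by move=> [x [y [ax bY]]]; apply: cong_trans; apply: opP.
by move=> h; exists a, b; split=> //; apply: cong_refl.
Qed.

Definition quot_op (op : A -> A -> A)
    (opP : forall x x' y y', alpha x x' -> alpha y y' ->
      alpha (op x y) (op x' y')) (X Y : quot_carrier) : quot_carrier :=
  exist _ _ (quot_op_subproof opP X Y).

Lemma quot_opE (op : A -> A -> A)
    (opP : forall x x' y y', alpha x x' -> alpha y y' ->
      alpha (op x y) (op x' y')) (a b : A) :
  quot_op opP (quot_class a) (quot_class b) = quot_class (op a b).
Proof.
apply: eq_exist; apply/seteqP; split=> c /=.
  by move=> [x [y [ax bY]]]; apply: cong_trans; apply: opP.
by move=> h; exists a, b; split=> //; apply: cong_refl.
Qed.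

Definition quot_mul := quot_op (@cong_mul A alpha).
Definition quot_ldiv := quot_op (@cong_ldiv A alpha).

Lemma quot_inhabited : inhabited quot_carrier.
Proof. by case: (lq_inhabited A) => a; exists; exact: quot_class a. Qed.

Lemma quot_mulK X Y : quot_mul X (quot_ldiv X Y) = Y.
Proof.
have [a ->] := quot_class_surj X; have [b ->] := quot_class_surj Y.
by rewrite /quot_mul /quot_ldiv !quot_opE lq_mulK.
Qed.

Lemma quot_ldivK X Y : quot_ldiv X (quot_mul X Y) = Y.
Proof.
have [a ->] := quot_class_surj X; have [b ->] := quot_class_surj Y.
by rewrite /quot_mul /quot_ldiv !quot_opE lq_ldivK.
Qed.

Definition quotient : leftQuasigroup :=
  LeftQuasigroup quot_inhabited quot_mulK quot_ldivK.

Variables (beta : congruence A) (le_ab : cong_le alpha beta).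

Definition quot_rel (X Y : quotient) : Prop :=
  exists a b, [/\ sval X a, sval Y b & beta a b].

Lemma quot_relE (a b : A) :
  quot_rel (quot_class a) (quot_class b) <-> beta a b.
Proof.
split=> [[x [y /= [/le_ab ax /le_ab bY xy]]]|ab].
  exact: cong_trans ax (cong_trans xy (cong_sym bY)).
by exists a, b; split=> //; apply: cong_refl.
Qed.

(* beta / alpha, a congruence of A / alpha when alpha <= beta *)
Definition quot_cong : congruence quotient.
Proof.
apply: (@Congruence quotient quot_rel).
- by move=> X; have [a ->] := quot_class_surj X; apply/quot_relE/cong_refl.
- by move=> X Y [a [b [Xa Yb ab]]]; exists b, a; split=> //; apply: cong_sym.
- move=> X Y Z; have [a ->] := quot_class_surj X.
  have [b ->] := quot_class_surj Y; have [c ->] := quot_class_surj Z.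
  move=> /quot_relE ab /quot_relE bc.
  by apply/quot_relE; apply: cong_trans ab bc.
- move=> X X' Y Y'; have [a ->] := quot_class_surj X.
  have [a' ->] := quot_class_surj X'; have [b ->] := quot_class_surj Y.
  have [b' ->] := quot_class_surj Y' => /quot_relE aa' /quot_relE bb'.
  rewrite /= /quot_mul !quot_opE; apply/quot_relE; exact: cong_mul.
- move=> X X' Y Y'; have [a ->] := quot_class_surj X.
  have [a' ->] := quot_class_surj X'; have [b ->] := quot_class_surj Y.
  have [b' ->] := quot_class_surj Y' => /quot_relE aa' /quot_relE bb'.
  rewrite /= /quot_ldiv !quot_opE; apply/quot_relE; exact: cong_ldiv.
Defined.

End Quotient.

Definition central_chain (A : leftQuasigroup) (m : nat)
    (alpha : nat -> congruence A) : Prop :=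
  [/\ forall x y, alpha 0 x y <-> cong0 A x y,
      forall x y, alpha m x y <-> cong1 A x y &
      forall i, i < m -> exists le_i : cong_le (alpha i) (alpha i.+1),
        central (quot_cong le_i)].

Definition has_central_chain (A : leftQuasigroup) (m : nat) : Prop :=
  exists alpha : nat -> congruence A, central_chain m alpha.

Definition nilpotent (A : leftQuasigroup) : Prop :=
  exists m, has_central_chain A m.

Definition nilpotence_length (A : leftQuasigroup) (m : nat) : Prop :=
  has_central_chain A m /\ forall n, has_central_chain A n -> m <= n.

(* Main.v *)
Require Import Defs.
From mathcomp Require Import all_boot.
From mathcomp Require Import boolp.

(** Let [Dis] be the group generated by the permutations [L_a L_b^-1].
    Mediality yields, for [h] in [Dis], displacements [c h] and [phi h] not
    depending on [x, y] such that [h x * y = c h (x * y)] and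
    [x * h y = phi h (x * y)].  Hence, by induction on a term [t],
    [t (h a, u) = h' (t (a, u))] with [h'] in [Dis] independent of [u], so the
    orbit congruence of [Dis] is central.  Modulo this congruence [x * y] and
    [x \ y] do not depend on [x], so every term depends on its rightmost
    variable only and the quotient is abelian. *)

Set Implicit Arguments.
Unset Strict Implicit.
Unset Printing Implicit Defensive.

Local Open Scope lquasi_scope.

Section LeftQuasigroup.
Variable Q : leftQuasigroup.
Implicit Types (a b x y z u w : Q) (s : seq (Q * Q)).

Lemma lq_mul_inj x y z : x * y = x * z -> y = z.
Proof. by move=> e; rewrite -(lq_ldivK x y) e lq_ldivK. Qed.

(* The word [(a1, b1) ... (an, bn)] acts as
   [L_a1 L_b1^-1 ... L_an L_bn^-1]. *)
Definition disp s x : Q := foldr (fun p y => p.1 * (p.2 \ y)) x s.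

Lemma disp_cat s1 s2 x : disp (s1 ++ s2) x = disp s1 (disp s2 x).
Proof. exact: foldr_cat. Qed.

Definition disp_inv s : seq (Q * Q) := rev [seq (p.2, p.1) | p <- s].

Lemma disp_invK s x : disp (disp_inv s) (disp s x) = x.
Proof.
elim: s => [//|[a b] s IHs] /=.
by rewrite /disp_inv /= rev_cons -cats1 disp_cat /= lq_ldivK lq_mulK.
Qed.

Definition orbit x y : Prop := exists s, disp s x = y.

Lemma orbit_refl x : orbit x x. Proof. by exists [::]. Qed.

Lemma orbit_sym x y : orbit x y -> orbit y x.
Proof. by case=> s <-; exists (disp_inv s); apply: disp_invK. Qed.

Lemma orbit_trans x y z : orbit x y -> orbit y z -> orbit x z.
Proof. by move=> [s <-] [r <-]; exists (r ++ s); apply: disp_cat. Qed.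

Lemma orbit_mulr x x' y : orbit (x * y) (x' * y).
Proof. by exists [:: (x', x)]; rewrite /= lq_ldivK. Qed.

End LeftQuasigroup.

Section QuotientCentral.
Variables (A : leftQuasigroup) (alpha beta : congruence A).
Hypothesis le_ab : cong_le alpha beta.

Lemma term_eval_quot n (e : 'I_n -> A) (t : term n) :
  term_eval (fun i => quot_class alpha (e i) : quotient alpha) t
  = quot_class alpha (term_eval e t).
Proof.
elim: t => [//|t1 IH1 t2 IH2|t1 IH1 t2 IH2] /=; rewrite IH1 IH2.
  exact: quot_opE.
exact: quot_opE.
Qed.

Lemma env_cons_comp T T' (f : T -> T') k (a : T) (u : 'I_k -> T) :
  env_cons (f a) (fun i => f (u i)) = (fun i => f (env_cons a u i)).
Proof. by apply: funext => i; rewrite /env_cons; case: unlift. Qed.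

(** Evaluation commutes with the quotient map, so after choosing representatives centrality in the
    quotient becomes a condition on terms in [A] itself. *)
Lemma central_quot_cong :
  centralizes beta (cong1 A) alpha -> central (quot_cong le_ab).
Proof.
move=> C k t X Y U V.
have [a ->] := quot_class_surj X; have [b ->] := quot_class_surj Y.
have [u /funext ->] := choice (fun i => quot_class_surj (U i)).
have [v /funext ->] := choice (fun i => quot_class_surj (V i)).
move=> /(quot_relE le_ab) ab _ /=.
rewrite !(@env_cons_comp A (quotient alpha) (quot_class alpha)).
rewrite !term_eval_quot.
by move=> /quot_classP h; apply/quot_classP; apply: C ab _ h.
Qed.

End QuotientCentral.

Section Medial.
Variables (Q : leftQuasigroup) (Qmedial : medial Q).
Implicit Types (a b x y z u w : Q) (s : seq (Q * Q)).

(** For one letter [(a, b)], put [w = b * v] and [y = z * r]. Mediality gives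
    [(a * v) * (z * r) = (a * z) * (v * r)], and likewise with [b] for [a]. As [z] is arbitrary, the
    new word is independent of [x] and [y]. *)
Lemma disp_mull z s x y :
  disp s x * y = disp [seq (p.1 * z, p.2 * z) | p <- s] (x * y).
Proof.
elim: s => [//|[a b] s /= <-]; set w := disp s x.
set v := b \ w; set r := z \ y.
have -> : y = z * r by rewrite lq_mulK.
have -> : w = b * v by rewrite lq_mulK.
by rewrite !(Qmedial _ v z) lq_ldivK.
Qed.

Lemma disp_mulr z s x y :
  x * disp s y = disp [seq (z * p.1, z * p.2) | p <- s] (x * y).
Proof.
elim: s => [//|[a b] s /= <-]; set w := disp s y.
set v := z \ x; set r := b \ w.
have -> : x = z * v by rewrite lq_mulK.
have -> : w = b * r by rewrite lq_mulK.
by rewrite !(Qmedial z v) lq_ldivK.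
Qed.

Lemma disp_ldivr z s x y :
  x \ disp s y = disp [seq (z \ p.1, z \ p.2) | p <- s] (x \ y).
Proof.
apply: (@lq_mul_inj _ x); rewrite (disp_mulr z) !lq_mulK -map_comp.
by congr disp; rewrite -[LHS]map_id; apply: eq_map => -[a b] /=; rewrite !lq_mulK.
Qed.

Lemma disp_ldivl z s x y :
  disp s x \ y = x \ disp (disp_inv [seq (p.1 * z, p.2 * z) | p <- s]) y.
Proof.
apply: (@lq_mul_inj _ x); rewrite lq_mulK.
(* Writing [y] as [disp s x * (disp s x \ y)] lets [disp_mull] extract a word that [disp_inv]
   cancels. *)
by rewrite -[in RHS](lq_mulK (disp s x) y) (disp_mull z) disp_invK.
Qed.

(** Changing the left factor stays within an orbit, and each left translation permutes the
    orbits. *)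
Lemma orbit_mulE x x' y y' : orbit (x * y) (x' * y') <-> orbit y y'.
Proof.
split=> [|[s <-]].
  move/orbit_trans/(_ (orbit_mulr x' x y')) => -[s e].
  exists [seq (x \ p.1, x \ p.2) | p <- s].
  by rewrite -(lq_ldivK x y) -disp_ldivr e lq_ldivK.
apply: orbit_trans (orbit_mulr x x' y) _.
by exists [seq (x * p.1, x * p.2) | p <- s]; rewrite (disp_mulr x).
Qed.

Lemma orbit_ldivE x x' y y' : orbit (x \ y) (x' \ y') <-> orbit y y'.
Proof. by rewrite -(orbit_mulE x x') !lq_mulK. Qed.

Definition orbit_cong : congruence Q :=
  Congruence (@orbit_refl Q) (@orbit_sym Q) (@orbit_trans Q)
    (fun x x' y y' _ => (orbit_mulE x x' y y').2)
    (fun x x' y y' _ => (orbit_ldivE x x' y y').2).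

Lemma term_eval_disp k (t : term k.+1) s a :
  exists s', forall u : 'I_k -> Q,
    term_eval (env_cons (disp s a) u) t
    = disp s' (term_eval (env_cons a u) t).
Proof.
elim: t => [i|t1 [s1 IH1] t2 [s2 IH2]|t1 [s1 IH1] t2 [s2 IH2]] /=.
- rewrite /env_cons; case: unlift => [j|]; last by exists s.
  by exists [::].
(* The element [a] serves as the free parameter [z], which keeps the word independent of [u]. *)
- exists ([seq (p.1 * a, p.2 * a) | p <- s1]
    ++ [seq (a * p.1, a * p.2) | p <- s2]) => u.
  by rewrite IH1 IH2 (disp_mull a) (disp_mulr a) disp_cat.
- exists [seq (a \ p.1, a \ p.2)
    | p <- disp_inv [seq (p.1 * a, p.2 * a) | p <- s1] ++ s2] => u.
  by rewrite IH1 IH2 (disp_ldivl a) -disp_cat (disp_ldivr a).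
Qed.

(** One word [s'] carries the values at [u] and at [v], so their equality is preserved. *)
Lemma orbit_cong_central : centralizes orbit_cong (cong1 Q) (cong0 Q).
Proof.
move=> k t a _ u v [s <-] _ /= e.
by have [s' es'] := term_eval_disp t s a; rewrite !es' e.
Qed.

(** The index [i] is that of the rightmost variable of [t]. *)
Lemma orbit_term_eval n (t : term n) :
  exists i, forall e e' : 'I_n -> Q,
    orbit (term_eval e t) (term_eval e' t) <-> orbit (e i) (e' i).
Proof.
elim: t => [i|t1 _ t2 [i IH]|t1 _ t2 [i IH]] /=; exists i => e e' //.
  by rewrite orbit_mulE.
by rewrite orbit_ldivE.
Qed.

Lemma orbit_cong_abelian : centralizes (cong1 Q) (cong1 Q) orbit_cong.
Proof.
move=> k t a b u v _ _ /=; have [i it] := orbit_term_eval t.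
(* If the rightmost variable is one of the [u j], hypothesis and goal coincide; otherwise the goal
   relates [b] to itself. *)
rewrite !it /env_cons; case: unlift => // _; exact: orbit_refl.
Qed.

Lemma medial_central_chain : has_central_chain Q 2.
Proof.
exists (fun i => if i is j.+1 then if j is _.+1 then cong1 Q else orbit_cong
                 else cong0 Q).
split=> // -[|[|//]] _.
  have le : cong_le (cong0 Q) orbit_cong by move=> x y ->; apply: orbit_refl.
  by exists le; apply/central_quot_cong/orbit_cong_central.
have le : cong_le orbit_cong (cong1 Q) by [].
by exists le; apply/central_quot_cong/orbit_cong_abelian.
Qed.

End Medial.

Theorem corollary4p4 (Q : leftQuasigroup) (Qmedial : medial Q) :
  nilpotent Q /\ exists2 m : nat, nilpotence_length Q m & m <= 2.
Proof.
have chain2 := medial_central_chain Qmedial; split; first by exists 2.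
(* Classical reflection makes the predicate boolean, so that a least length can be extracted. *)
have ex : exists n, `[< has_central_chain Q n >] by exists 2; apply/asboolP.
case: (ex_minnP ex) => m /asboolP chainm minm.
exists m; last exact/minm/asboolP.
by split=> // n /asboolP; apply: minm.
Qed.
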